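(* Let $c>0$ and $\beta>1$, and for $a,b>0$ let $$f(a,b)=\int_0^\infty u^{-\beta}\,e^{-c\left[\sqrt u\,b-\frac{a}{\sqrt u}\right]^2}\,du.$$ Then there exist constants $0<C_1\le C_2<\infty$ depending only on $\beta$ and $c$ such that for all $a,b>0$, $$C_1\,\frac{(1+4ab)^{\beta-3/2}}{a^{2(\beta-1)}}\le f(a,b)\le C_2\,\frac{(1+4ab)^{\beta-3/2}}{a^{2(\beta-1)}}.$$ *)

(* Defs.v *)
From HB Require Import structures.
From mathcomp Require Import all_boot all_order all_algebra.
From mathcomp Require Import all_classical all_reals all_analysis.

Set Implicit Arguments.
Unset Strict Implicit.
Unset Printing Implicit Defensive.

Import Order.TTheory GRing.Theory Num.Theory.
Import numFieldNormedType.Exports.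

Local Open Scope classical_set_scope.
Local Open Scope ring_scope.

(* The integrand is nonnegative, so its Lebesgue integral always exists in
   [0, +oo]; an upper bound of [f_int] by a real number thus includes the
   convergence of the integral. *)
Definition f_int (R : realType) (c beta a b : R) : \bar R :=
  (\int[@lebesgue_measure R]_(u in `]0%R, +oo[)
     (u `^ (- beta)
      * expR (- c * (Num.sqrt u * b - a / Num.sqrt u) ^+ 2))%:E)%E.

(* Main.v *)
Require Import Defs.
From HB Require Import structures.
From mathcomp Require Import all_boot all_order all_algebra.
From mathcomp Require Import all_classical all_reals all_analysis.
From mathcomp Require Import measurable_realfun ring lra.

Import Order.TTheory GRing.Theory Num.Theory.
Import numFieldNormedType.Exports.

Local Open Scope classical_set_scope.
Local Open Scope ring_scope.

(** The exponent is [c (u b - a)^2 / u], so the integrand peaks near [u = a / b]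
    when [a b] is large and decays like [exp (- c a^2 / u)] near 0.  With
    [T = 1 + 4 a b], [t = T^(-1/2)] and [L = 4 a^2 / T], the claimed rate is a
    constant times [L^(1 - beta) t].  On [[L, L + L t]] the exponent is at most
    [c / 4], which gives the lower bound.  For the upper bound, cut at [L / 2] and
    [4 L]: below [L / 2] the exponential beats [u^(-beta)]; between the cuts the
    integrand is at most [(L / 2)^(-beta)] times a Gaussian of deviation of order
    [L t]; above [4 L] the exponential is at most a constant times [t], and
    [u^(-beta)] is integrable.  When [T <= 2], [t] is bounded below and the bound
    by [u^(-beta)] is enough above [L / 2]. *)

(** * Elementary estimates and model integrals *)

(** From [expR (x / p) >= 1 + x / p >= x / p]: invert, then raise to the power [p]. *)
Lemma expRN_le_powR (R : realType) (p x : R) : 0 < p -> 0 < x ->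
  expR (- x) <= (p / x) `^ p.
Proof.
move=> p0 x0.
have -> : - x = - (x / p) * p by field; rewrite gt_eqF.
rewrite expRM ge0_ler_powR ?(ltW p0) ?nnegrE ?expR_ge0 ?divr_ge0 ?(ltW x0) ?(ltW p0) //.
rewrite expRN -[p / x]invf_div lef_pV2 ?posrE ?expR_gt0 ?divr_gt0 //.
by apply: le_trans (expR_ge1Dx _); rewrite lerDr.
Qed.

Lemma powR_cvgy (R : realType) (k : R) : 0 < k ->
  x `^ k @[x --> +oo] --> +oo.
Proof.
move=> k0; apply/cvgryPge => A; near=> x.
have A0 : 0 <= Num.max A 0 by rewrite le_max lexx orbT.
apply: (@le_trans _ _ (Num.max A 0)); first by rewrite le_max lexx.
rewrite -[leLHS](powRr1 A0) -(@mulVf _ k) ?gt_eqF // powRrM.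
by rewrite ge0_ler_powR ?(ltW k0) ?nnegrE ?powR_ge0.
Unshelve. all: by end_near. Qed.

Lemma integral_powR_tail (R : realType) (p A : R) : 1 < p -> 0 < A ->
  (\int[@lebesgue_measure R]_(u in `[A, +oo[) (u `^ (- p))%:E
     = (A `^ (1 - p) / (p - 1))%:E)%E.
Proof.
move=> p1 A0; have q0 : p - 1 != 0 by rewrite subr_eq0 gt_eqF.
pose F (u : R) := - (p - 1)^-1 * u `^ (1 - p).
have dF (x : R) : 0 < x -> is_derive x 1 F (x `^ (- p)).
  move=> x0; rewrite /F.
  have h := is_derive1_powR (1 - p) x0.
  apply: is_derive_eq.
  rewrite /GRing.scale/= (_ : 1 - p - 1 = - p); last by ring.
  by field.
have cF (x : R) : 0 < x -> {for x, continuous F}.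
  move=> x0; apply: differentiable_continuous.
  by apply/derivable1_diffP; have [] := dF x x0.
have cf (x : R) : 0 < x -> {for x, continuous (fun u : R => u `^ (- p))}.
  move=> x0; apply: differentiable_continuous.
  by apply/derivable1_diffP; have [] := is_derive1_powR (- p) x0.
have -> : A `^ (1 - p) / (p - 1) = 0 - F A.
  by rewrite /F add0r mulNr opprK mulrC.
rewrite EFinB; apply: (@ge0_continuous_FTC2y R (fun u => u `^ (- p)) F A 0).
- by move=> x _; exact: powR_ge0.
- apply/continuous_within_itvcyP; split.
    by move=> x; rewrite in_itv/= andbT => /(lt_trans A0)/cf.
  exact/cvg_at_right_filter/cf.
(* The antiderivative vanishes at infinity: [u ^ (1 - p)] is the inverse of [u ^ (p - 1)], which
   diverges as [p > 1]. *)
- rewrite -[X in _ --> X](mulr0 (- (p - 1)^-1)); apply: cvgMl_tmp.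
  have -> : (fun u : R => u `^ (1 - p)) = (fun u => (u `^ (p - 1))^-1).
    by apply/funext => u; rewrite -powRN opprB.
  apply/gtr0_cvgV0; last by apply: powR_cvgy; rewrite subr_gt0.
  by near=> x; rewrite powR_gt0.
- by move=> x Ax; have [] := dF x (lt_trans A0 Ax).
- exact/cvg_at_right_filter/cF.
- move=> x; rewrite in_itv/= andbT => Ax.
  by rewrite derive1E; have [_ ->] := dF x (lt_trans A0 Ax).
Unshelve. all: by end_near. Qed.

(** The integrand is [s * sqrt (2 pi)] times the normal density, whose total mass is 1. *)
Lemma le_integral_gauss (R : realType) (m s : R) (D : set R) : 0 < s ->
  measurable D ->
  (\int[@lebesgue_measure R]_(u in D) (expR (- (u - m) ^+ 2 / (s ^+ 2 *+ 2)))%:E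
     <= (s * Num.sqrt (pi *+ 2))%:E)%E.
Proof.
move=> s0 mD.
have sn0 : s != 0 by rewrite gt_eqF.
have k0 : s * Num.sqrt (pi *+ 2) != 0.
  by rewrite mulf_neq0// gt_eqF// sqrtr_gt0 mulrn_wgt0// pi_gt0.
have E (u : R) : expR (- (u - m) ^+ 2 / (s ^+ 2 *+ 2)) =
    s * Num.sqrt (pi *+ 2) * normal_pdf m s u.
  rewrite normal_pdfE// /normal_peak -mulrnAr sqrtrM ?sqr_ge0// sqrtr_sqr.
  by rewrite gtr0_norm// mulrA mulfV// mul1r.
under eq_integral do rewrite E EFinM.
rewrite ge0_integralZl_EFin//.
- rewrite -[leRHS]mule1 lee_pmul2l ?fin_numE// ?lte_fin; last first.
    by rewrite lt_def k0 mulr_ge0 ?sqrtr_ge0// ltW.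
  rewrite -(integral_normal_pdf m s); apply: ge0_subset_integral => //.
    by apply/measurable_EFinP; exact: measurable_normal_pdf.
  by move=> u _; rewrite lee_fin normal_pdf_ge0.
- by move=> u _; rewrite lee_fin normal_pdf_ge0.
- apply/measurable_EFinP/measurable_funTS; exact: measurable_normal_pdf.
- by rewrite mulr_ge0 ?sqrtr_ge0// ltW.
Qed.

Lemma ler_powRN (R : realType) (p x y : R) : 0 <= p -> 0 < x -> x <= y ->
  y `^ (- p) <= x `^ (- p).
Proof.
move=> p0 x0 xy; have y0 := lt_le_trans x0 xy.
by rewrite !powRN lef_pV2 ?posrE ?powR_gt0// ge0_ler_powR ?nnegrE ?(ltW x0) ?(ltW y0).
Qed.

Lemma integral_le_cst (R : realType) (d : measure_display)
    (T : measurableType d) (mu : {measure set T -> \bar R}) (D : set T)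
    (h : T -> R) (k l : R) :
  measurable D -> mu D = l%:E -> measurable_fun D h ->
  (forall u, D u -> 0 <= h u <= k) ->
  (\int[mu]_(u in D) (h u)%:E <= (k * l)%:E)%E.
Proof.
move=> mD Dl mh hk; rewrite EFinM -Dl -integral_cst//.
apply: ge0_le_integral => //.
- by move=> u /hk/andP[? _]; rewrite lee_fin.
- exact/measurable_EFinP.
- by move=> u /hk/andP[_ ?]; rewrite lee_fin.
Qed.

Lemma integral_ge_cst (R : realType) (d : measure_display)
    (T : measurableType d) (mu : {measure set T -> \bar R}) (D : set T)
    (h : T -> R) (k l : R) :
  measurable D -> mu D = l%:E -> measurable_fun D h -> 0 <= k ->
  (forall u, D u -> k <= h u) ->
  ((k * l)%:E <= \int[mu]_(u in D) (h u)%:E)%E.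
Proof.
move=> mD Dl mh k0 hk; rewrite EFinM -Dl -integral_cst//.
by apply: ge0_le_integral => //; exact/measurable_EFinP.
Qed.

Lemma ge0_integral_itv_split (R : realType) (a : itv_bound R) (x : R)
    (h : R -> R) :
  (a <= BLeft x)%O -> measurable_fun setT h -> (forall u, 0 <= h u) ->
  (\int[@lebesgue_measure R]_(u in [set` Interval a +oo%O]) (h u)%:E =
   \int[@lebesgue_measure R]_(u in [set` Interval a (BLeft x)]) (h u)%:E +
   \int[@lebesgue_measure R]_(u in `[x, +oo[) (h u)%:E)%E.
Proof.
move=> ax mh h0; rewrite (@itv_bndbnd_setU _ _ _ (BLeft x))//.
rewrite ge0_integral_setU//=.
- by apply/measurable_EFinP; exact: measurable_funTS.
- by move=> u _; rewrite lee_fin.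
- apply/disj_setPS => y [/=]; rewrite !itv_boundlr/= => /andP[_ yx] /andP[].
  by rewrite !bnd_simp in yx *; rewrite leNgt yx.
Qed.

(** * The integrand without square roots *)

(* [u^-1] is written as a power because [powR] is known to be measurable. *)
Definition f_integrand {R : realType} (c beta a b u : R) : R :=
  u `^ (- beta) * expR (- c * ((u * b - a) ^+ 2 * u `^ (-1))).

(** For [u > 0], [sqrt u * b - a / sqrt u = (u * b - a) / sqrt u]. *)
Lemma f_int_integrandE (R : realType) (c beta a b : R) :
  f_int c beta a b =
  (\int[@lebesgue_measure R]_(u in `]0%R, +oo[) (f_integrand c beta a b u)%:E)%E.
Proof.
apply: eq_integral => u; rewrite inE/= in_itv/= andbT => u0.
rewrite /f_integrand (powR_inv1 (ltW u0)); congr (_ * expR (_ * _))%:E.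
have s0 : Num.sqrt u != 0 by rewrite gt_eqF// sqrtr_gt0.
rewrite -[in RHS](sqr_sqrtr (ltW u0)).
by field.
Qed.

Lemma measurable_f_integrand (R : realType) (c beta a b : R) (D : set R) :
  measurable_fun D (f_integrand c beta a b).
Proof.
apply: measurable_funTS; apply: measurable_funM => //.
apply: measurableT_comp => //; apply: measurable_funM => //.
apply: measurable_funM => //; apply: measurable_funX.
by apply: measurable_funB => //; exact: measurable_funM.
Qed.

Lemma f_integrand_ge0 (R : realType) (c beta a b u : R) :
  0 <= f_integrand c beta a b u.
Proof. by rewrite mulr_ge0 ?powR_ge0 ?expR_ge0. Qed.

Lemma f_integrand_le (R : realType) (c beta a b u : R) : 0 < c -> 0 < u ->
  f_integrand c beta a b u <= u `^ (- beta).
Proof.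
move=> c0 u0; rewrite ler_piMr ?powR_ge0// -expR0 ler_expR mulNr oppr_le0.
by rewrite (mulr_ge0 (ltW c0))// mulr_ge0 ?sqr_ge0 ?powR_ge0.
Qed.

(** * Bounds in the scale [L] and relative width [t] *)

Section scaled_bounds.
Context {R : realType}.
Variables (c beta a b t L : R).
Hypotheses (c0 : 0 < c) (beta1 : 1 < beta) (a0 : 0 < a) (b0 : 0 < b).
Hypotheses (t0 : 0 < t) (t1 : t <= 1).
(** Together these encode [t ^ 2 * (1 + 4ab) = 1] polynomially. The second places [L] at
    [(1 - t ^ 2)] times the zero [a / b] of the exponent. *)
Hypotheses (LE : L = 4 * a ^+ 2 * t ^+ 2) (LbE : L * b = a * (1 - t ^+ 2)).

Local Notation g := (f_integrand c beta a b).
Local Notation mu := (@lebesgue_measure R).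

Let L0 : 0 < L.
Proof. by rewrite LE !mulr_gt0 ?exprn_gt0 ?ltr0n. Qed.

Let beta0 : 0 < beta.
Proof. exact: lt_trans beta1. Qed.

Let LbetaE (k : R) : 0 <= k -> (k * L) `^ (1 - beta) = k `^ (1 - beta) * L `^ (1 - beta).
Proof. by move=> k0; rewrite powRM// ltW. Qed.

Let L1beta : L `^ (1 - beta) = L `^ (- beta) * L.
Proof.
rewrite addrC powRD; last by rewrite (gt_eqF L0) implybT.
by rewrite powRr1// ltW.
Qed.

(** Here [u * b - a] is the difference of [(u - L) * b] and [a * t ^ 2], both in [[0, a * t]]. Hence
    its square is at most [(a * t) ^ 2 = L / 4 <= u / 4]. *)
Lemma f_integrand_core_ge u : L <= u <= L + L * t ->
  (2 * L) `^ (- beta) * expR (- (c / 4)) <= g u.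
Proof.
move=> /andP[Lu uL]; have u0 := lt_le_trans L0 Lu.
have Lt : L * t <= L by rewrite ger_pMr.
apply: ler_pM; rewrite ?powR_ge0 ?expR_ge0//.
  by apply: ler_powRN => //; [exact: ltW|lra].
rewrite ler_expR (powR_inv1 (ltW u0)) -mulNr ler_nM2l ?oppr_lt0//.
rewrite ler_pdivrMr//.
suff : (u * b - a) ^+ 2 <= (a * t) ^+ 2.
  have : (a * t) ^+ 2 = L / 4 by rewrite LE; field.
  lra.
have h1 : 0 <= (u - L) * b by rewrite mulr_ge0 ?subr_ge0 ?(ltW b0).
have h2 : (u - L) * b <= a * t.
  apply: (@le_trans _ _ (L * t * b)); first by rewrite ler_pM2r//; lra.
  rewrite mulrAC LbE ler_pM2r// ger_pMr// gerBl sqr_ge0//.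
have h3 : u * b - a = (u - L) * b - a * t ^+ 2.
  by rewrite mulrBl LbE; ring.
have h4 : 0 <= a * t ^+ 2 <= a * t.
  by rewrite mulr_ge0 ?sqr_ge0 ?(ltW a0)//= ler_pM2l// expr2 ger_pMr.
rewrite -[leLHS]real_normK ?num_real// ler_sqr ?nnegrE ?mulr_ge0 ?(ltW a0) ?(ltW t0)//.
rewrite h3 ler_norml; lra.
Qed.

Lemma f_int_ge_scaled :
  ((2 `^ (- beta) * expR (- (c / 4)) * (L `^ (1 - beta) * t))%:E
    <= f_int c beta a b)%E.
Proof.
rewrite f_int_integrandE.
have -> : 2 `^ (- beta) * expR (- (c / 4)) * (L `^ (1 - beta) * t) =
    (2 * L) `^ (- beta) * expR (- (c / 4)) * (L + L * t - L).
  rewrite powRM ?(ltW L0)// L1beta; ring.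
apply: (@le_trans _ _ (\int[mu]_(u in `[L, (L + L * t)%R]) (g u)%:E)%E).
  apply: integral_ge_cst => //.
  - by rewrite /= lebesgue_measure_itv/= lte_fin ltrDl mulr_gt0// -EFinD.
  - exact: measurable_f_integrand.
  - by rewrite mulr_ge0 ?powR_ge0 ?expR_ge0.
  - by move=> u /=; rewrite in_itv/=; exact: f_integrand_core_ge.
apply: ge0_subset_integral => //.
- by apply/measurable_EFinP; exact: measurable_f_integrand.
- by move=> u _; rewrite lee_fin f_integrand_ge0.
- by move=> u /=; rewrite !in_itv/= andbT => /andP[/(lt_le_trans L0)].
Qed.

(** Since [L * b <= a], here [u * b <= a / 2], so [(u * b - a) ^ 2] is at least
    [a ^ 2 / 4 = L / (16 t ^ 2)]. Bounding the exponential by a power with exponent [beta] produces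
    [u ^ beta], which cancels the singularity at 0. *)
Lemma f_integrand_head_le u : 0 < u < L / 2 ->
  g u <= (16 * beta / c) `^ beta * L `^ (- beta) * t.
Proof.
move=> /andP[u0 /ltW uL].
have hE : expR (- c * ((u * b - a) ^+ 2 * u `^ (-1))) <=
    expR (- (c * L / (16 * t ^+ 2 * u))).
  rewrite ler_expR (powR_inv1 (ltW u0)) mulNr lerN2 -mulrA ler_pM2l//.
  rewrite (_ : L / _ = (a / 2) ^+ 2 / u); last by rewrite LE; field; rewrite !gt_eqF.
  rewrite ler_pM2r ?invr_gt0//.
  have ub : u * b <= a / 2.
    apply: (@le_trans _ _ (L / 2 * b)); first by rewrite ler_pM2r.
    by rewrite mulrAC LbE ler_pM2r ?invr_gt0// ger_pMr// gerBl sqr_ge0.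
  rewrite -[leRHS]sqrrN ler_sqr ?nnegrE; first by lra.
    by rewrite divr_ge0 ?(ltW a0).
  by move: (a0); lra.
rewrite /f_integrand; apply: le_trans (ler_wpM2l (powR_ge0 _ _) hE) _.
have x0 : 0 < c * L / (16 * t ^+ 2 * u) by rewrite !(mulr_gt0, invr_gt0, exprn_gt0).
apply: le_trans (ler_wpM2l (powR_ge0 _ _) (expRN_le_powR _ _ _ beta0 x0)) _.
have -> : beta / (c * L / (16 * t ^+ 2 * u)) = 16 * beta / c * L^-1 * t ^+ 2 * u.
  by field; rewrite !gt_eqF.
have k0 : 0 <= 16 * beta / c by rewrite divr_ge0 ?(ltW c0)// mulr_ge0// ltW.
have Li0 : 0 <= L^-1 by rewrite invr_ge0 ltW.
rewrite (powRM _ (mulr_ge0 (mulr_ge0 k0 Li0) (sqr_ge0 t)) (ltW u0)).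
rewrite (powRM _ (mulr_ge0 k0 Li0) (sqr_ge0 t)) (powRM _ k0 Li0).
have uu : u `^ (- beta) * u `^ beta = 1.
  by rewrite powRN mulVf// gt_eqF// powR_gt0.
rewrite mulrCA uu mulr1.
rewrite -(powR_inv1 (ltW L0)) -powRrM mulN1r.
(* What remains is [t ^ (2 beta) <= t], from [t <= 1] and [2 beta >= 1]. *)
rewrite ler_wpM2l ?mulr_ge0 ?powR_ge0// -(powR_mulrn _ (ltW t0)) -powRrM.
by rewrite ge1r_powR ?t0//; move: beta1; lra.
Qed.

Lemma integral_head_le :
  (\int[mu]_(u in `]0%R, (L / 2)%R[) (g u)%:E
    <= ((16 * beta / c) `^ beta / 2 * (L `^ (1 - beta) * t))%:E)%E.
Proof.
have -> : (16 * beta / c) `^ beta / 2 * (L `^ (1 - beta) * t) =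
    (16 * beta / c) `^ beta * L `^ (- beta) * t * (L / 2 - 0).
  by rewrite L1beta; field.
apply: integral_le_cst => //.
- by rewrite /= lebesgue_measure_itv/= lte_fin divr_gt0// -EFinD.
- exact: measurable_f_integrand.
- by move=> u /=; rewrite in_itv/= f_integrand_ge0; exact: f_integrand_head_le.
Qed.

(** As [t >= t ^ 2 >= 1/2], the factor [2 * t >= 1] can be inserted into the tail integral of
    [u ^ (- beta)]. *)
Lemma integral_body_le_large : 2^-1 <= t ^+ 2 ->
  (\int[mu]_(u in `[(L / 2)%R, +oo[) (g u)%:E
    <= (2 * 2^-1 `^ (1 - beta) / (beta - 1) * (L `^ (1 - beta) * t))%:E)%E.
Proof.
move=> t2; have L20 : 0 < L / 2 by rewrite divr_gt0.
apply: (@le_trans _ _ (\int[mu]_(u in `[(L / 2)%R, +oo[) (u `^ (- beta))%:E)%E).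
  apply: ge0_le_integral => //.
  - by move=> u _; rewrite lee_fin f_integrand_ge0.
  - by apply/measurable_EFinP; exact: measurable_f_integrand.
  - by apply/measurable_EFinP/measurable_funTS; exact: measurable_powR.
  - move=> u /=; rewrite in_itv/= andbT => /(lt_le_trans L20) u0.
    by rewrite lee_fin f_integrand_le.
rewrite integral_powR_tail// lee_fin mulrC [L / 2]mulrC LbetaE ?invr_ge0//.
rewrite [leLHS]mulrA.
set X := 2^-1 `^ _; set Y := L `^ _.
rewrite (_ : 2 * X / (beta - 1) * (Y * t) = (beta - 1)^-1 * X * Y * (2 * t)); last by ring.
rewrite ler_peMr// ?mulr_ge0 ?powR_ge0 ?invr_ge0 ?subr_ge0 ?(ltW beta1)//.
have : t ^+ 2 <= t by rewrite expr2 ger_pMr.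
lra.
Qed.

(** The exponent is [c * b ^ 2 * (u - a / b) ^ 2 / u]. With [u <= 4 L], [L * b >= a / 2] and
    [a ^ 2 = L / (4 t ^ 2)], one gets [b ^ 2 / u >= 1 / (64 (L t) ^ 2)]; the 32 in [s] makes
    [2 s ^ 2 = 64 (L t) ^ 2 / c]. *)
Lemma f_integrand_mid_le u (s := L * t * Num.sqrt (32 / c)) :
  t ^+ 2 <= 2^-1 -> L / 2 <= u <= 4 * L ->
  g u <= (L / 2) `^ (- beta) * expR (- (u - a / b) ^+ 2 / (s ^+ 2 *+ 2)).
Proof.
move=> t2 /andP[Lu uL]; have L20 : 0 < L / 2 by rewrite divr_gt0.
have u0 := lt_le_trans L20 Lu.
have s2E : s ^+ 2 *+ 2 = 64 * (L * t) ^+ 2 / c.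
  rewrite /s exprMn sqr_sqrtr ?divr_ge0 ?(ltW c0)//; rewrite -mulr_natr; field.
  by rewrite gt_eqF.
apply: ler_pM; rewrite ?powR_ge0 ?expR_ge0//.
  by apply: ler_powRN => //; exact: ltW.
rewrite ler_expR (powR_inv1 (ltW u0)) !mulNr lerN2 s2E invf_div.
rewrite mulrCA ler_pM2l//.
have -> : u * b - a = b * (u - a / b) by field; rewrite gt_eqF.
rewrite ler_pdivrMr; last by rewrite mulr_gt0// exprn_gt0// mulr_gt0.
set v := u - a / b.
have -> : (b * v) ^+ 2 / u * (64 * (L * t) ^+ 2) =
    v ^+ 2 * (64 * (L * b * t) ^+ 2 / u) by field; rewrite gt_eqF.
rewrite ler_peMr ?sqr_ge0// ler_pdivlMr// mul1r; apply: (le_trans uL).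
have -> : 4 * L = 64 * (a / 2 * t) ^+ 2 by rewrite LE; field.
have aLb : a / 2 <= L * b by rewrite LbE ler_pM2l//; lra.
have at0 : 0 <= a / 2 * t by rewrite mulr_ge0 ?divr_ge0 ?(ltW a0) ?(ltW t0).
rewrite ler_pM2l// ler_sqr ?nnegrE//; first by rewrite ler_pM2r.
by apply: le_trans at0 _; rewrite ler_pM2r.
Qed.

Lemma integral_mid_le : t ^+ 2 <= 2^-1 ->
  (\int[mu]_(u in `[(L / 2)%R, (4 * L)%R[) (g u)%:E
    <= (2^-1 `^ (- beta) * Num.sqrt (32 / c) * Num.sqrt (pi *+ 2)
        * (L `^ (1 - beta) * t))%:E)%E.
Proof.
move=> t2; have L20 : 0 < L / 2 by rewrite divr_gt0.
pose s := L * t * Num.sqrt (32 / c).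
have s0 : 0 < s by rewrite !mulr_gt0// sqrtr_gt0 divr_gt0.
have -> : 2^-1 `^ (- beta) * Num.sqrt (32 / c) * Num.sqrt (pi *+ 2)
    * (L `^ (1 - beta) * t) = (L / 2) `^ (- beta) * (s * Num.sqrt (pi *+ 2)).
  rewrite powRM ?invr_ge0 ?(ltW L0)// L1beta /s; ring.
have mG : measurable_fun `[(L / 2)%R, (4 * L)%R[
    (fun u : R => expR (- (u - a / b) ^+ 2 / (s ^+ 2 *+ 2))).
  by apply: measurable_funTS; exact: measurable_normal_fun.
apply: (@le_trans _ _ (\int[mu]_(u in `[(L / 2)%R, (4 * L)%R[)
    (((L / 2) `^ (- beta))%:E * (expR (- (u - a / b) ^+ 2 / (s ^+ 2 *+ 2)))%:E))%E).
  apply: ge0_le_integral => //.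
  - by move=> u _; rewrite lee_fin f_integrand_ge0.
  - by apply/measurable_EFinP; exact: measurable_f_integrand.
  - by apply: measurable_funeM; exact/measurable_EFinP.
  - move=> u /=; rewrite in_itv/= => /andP[Lu uL].
    by rewrite -EFinM lee_fin f_integrand_mid_le// Lu ltW.
rewrite ge0_integralZl_EFin ?powR_ge0//; last exact/measurable_EFinP.
  by rewrite EFinM lee_pmul2l ?fin_numE ?lte_fin ?powR_gt0// le_integral_gauss.
Qed.

(** Now [L * b >= a / 2] gives [u * b >= 2 a], so [u * b - a >= u * b / 2]. Then [(u * b - a) ^ 2 /
    u >= u * b ^ 2 / 4 >= L * b ^ 2 = (1 - t ^ 2) ^ 2 / (4 t ^ 2)], which is at least
    [1 / (16 t ^ 2)]. *)
Lemma f_integrand_far_le u : t ^+ 2 <= 2^-1 -> 4 * L <= u ->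
  g u <= 16 / c * t * u `^ (- beta).
Proof.
move=> t2 Lu; have u0 : 0 < u by apply: lt_le_trans Lu; rewrite mulr_gt0.
have k0 : 0 < 16 / c * t by rewrite mulr_gt0 ?divr_gt0.
rewrite [leRHS]mulrC; apply: ler_wpM2l; rewrite ?powR_ge0//.
have x0 : 0 < c / (16 * t ^+ 2) by rewrite !(mulr_gt0, invr_gt0, exprn_gt0).
apply: (@le_trans _ _ (expR (- (c / (16 * t ^+ 2))))).
  rewrite ler_expR (powR_inv1 (ltW u0)) mulNr lerN2 ler_pM2l//.
  have ub2 : 2 * a <= u * b.
    apply: (@le_trans _ _ (4 * L * b)); last by rewrite ler_pM2r.
    by rewrite -mulrA LbE mulrCA [2 * a]mulrC ler_pM2l//; lra.
  have h : (u * b / 2) ^+ 2 <= (u * b - a) ^+ 2.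
    have ub0 : 0 <= u * b / 2 by rewrite !mulr_ge0 ?ltW.
    have ub3 : u * b / 2 <= u * b - a by lra.
    by rewrite ler_sqr ?nnegrE//; exact: le_trans ub3.
  rewrite ler_pdivlMr//; apply: le_trans h.
  rewrite (_ : (u * b / 2) ^+ 2 = u * b ^+ 2 / 4 * u); last by field.
  rewrite ler_pM2r//.
  rewrite -div1r ler_pdivrMr ?mulr_gt0 ?exprn_gt0//.
  have e : (L * b) ^+ 2 * 4 * t ^+ 2 * 4 <= u * b ^+ 2 / 4 * (16 * t ^+ 2) * L.
    rewrite -subr_ge0.
    rewrite (_ : _ - _ = (u - 4 * L) * (4 * b ^+ 2 * t ^+ 2 * L)); last by field.
    by rewrite !mulr_ge0 ?subr_ge0 ?sqr_ge0// ltW.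
  rewrite -(ler_pM2r L0) mul1r; apply: le_trans e.
  rewrite LbE [leLHS]LE.
  rewrite (_ : _ * 4 = 16 * (1 - t ^+ 2) ^+ 2 * (a ^+ 2 * t ^+ 2)); last by ring.
  rewrite -mulrA ler_pM2r ?mulr_gt0 ?exprn_gt0//.
  by nra.
(* With exponent 1 the exponential is at most [16 t ^ 2 / c], and [t ^ 2 <= t]. *)
apply: le_trans (expRN_le_powR _ _ _ ltr01 x0) _.
rewrite powRr1 ?(divr_ge0 _ (ltW x0))//.
rewrite (_ : 1 / _ = 16 / c * t * t); last by field; rewrite !gt_eqF.
by rewrite ger_pMr.
Qed.

Lemma integral_far_le : t ^+ 2 <= 2^-1 ->
  (\int[mu]_(u in `[(4 * L)%R, +oo[) (g u)%:E
    <= (16 / c * (4 `^ (1 - beta) / (beta - 1)) * (L `^ (1 - beta) * t))%:E)%E.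
Proof.
move=> t2; have L40 : 0 < 4 * L by rewrite mulr_gt0.
have k0 : 0 < 16 / c * t by rewrite mulr_gt0 ?divr_gt0.
apply: (@le_trans _ _ (\int[mu]_(u in `[(4 * L)%R, +oo[)
    ((16 / c * t)%:E * (u `^ (- beta))%:E))%E).
  apply: ge0_le_integral => //.
  - by move=> u _; rewrite lee_fin f_integrand_ge0.
  - by apply/measurable_EFinP; exact: measurable_f_integrand.
  - apply: measurable_funeM; apply/measurable_EFinP/measurable_funTS.
    exact: measurable_powR.
  - move=> u /=; rewrite in_itv/= andbT => Lu.
    by rewrite -EFinM lee_fin f_integrand_far_le.
rewrite ge0_integralZl_EFin ?(ltW k0)//; last first.
- by apply/measurable_EFinP/measurable_funTS; exact: measurable_powR.
- by move=> u _; rewrite lee_fin powR_ge0.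
rewrite integral_powR_tail// -EFinM lee_fin LbetaE//.
by rewrite le_eqVlt; apply/orP; left; apply/eqP; ring.
Qed.

(** The constant adds the head, the body for [t ^ 2 >= 1/2], and the middle and far pieces for
    [t ^ 2 <= 1/2]. All terms are nonnegative, so one constant serves both cases. *)
Lemma f_int_le_scaled :
  (f_int c beta a b <= (((16 * beta / c) `^ beta / 2
     + (2 * 2^-1 `^ (1 - beta) / (beta - 1)
        + (2^-1 `^ (- beta) * Num.sqrt (32 / c) * Num.sqrt (pi *+ 2)
           + 16 / c * (4 `^ (1 - beta) / (beta - 1)))))
     * (L `^ (1 - beta) * t))%:E)%E.
Proof.
have mg : measurable_fun setT g by exact: measurable_f_integrand.
have g0 : forall u, 0 <= g u by move=> u; exact: f_integrand_ge0.
have M0 : 0 <= L `^ (1 - beta) * t by rewrite mulr_ge0 ?powR_ge0 ?(ltW t0).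
have b10 : 0 <= beta - 1 by rewrite subr_ge0 ltW.
rewrite f_int_integrandE (@ge0_integral_itv_split _ _ (L / 2))//; last first.
  by rewrite bnd_simp divr_gt0.
rewrite mulrDl EFinD; apply: leeD; first exact: integral_head_le.
rewrite mulrDl EFinD.
have [t2|/ltW t2] := leP 2^-1 (t ^+ 2).
  apply: le_trans (integral_body_le_large t2) _; rewrite leeDl// lee_fin mulr_ge0//.
  by rewrite addr_ge0// !mulr_ge0 ?powR_ge0 ?sqrtr_ge0 ?invr_ge0// ltW.
rewrite (@ge0_integral_itv_split _ _ (4 * L))//; last first.
  by rewrite bnd_simp; move: L0; lra.
apply: (@le_trans _ _ ((2^-1 `^ (- beta) * Num.sqrt (32 / c) * Num.sqrt (pi *+ 2)
    + 16 / c * (4 `^ (1 - beta) / (beta - 1))) * (L `^ (1 - beta) * t))%:E).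
  by rewrite [in leRHS]mulrDl EFinD leeD ?integral_mid_le ?integral_far_le.
by rewrite leeDr// lee_fin !mulr_ge0 ?powR_ge0 ?invr_ge0 ?(ltW t0).
Qed.

End scaled_bounds.

(** * Return to the stated rate *)

(** Exponent count: [a] gets [2 (1 - beta)] and [T] gets [- (1 - beta) - 1/2 = beta - 3/2]. *)
Lemma scaled_rateE (R : realType) (beta a T : R) : 0 < a -> 0 < T ->
  (4 * a ^+ 2 * (T `^ (- 2^-1)) ^+ 2) `^ (1 - beta) * T `^ (- 2^-1) =
  4 `^ (1 - beta) * (T `^ (beta - 3 / 2) / a `^ (2 * (beta - 1))).
Proof.
move=> a0 T0; have [a1 T1] := (ltW a0, ltW T0).
rewrite -(powR_mulrn _ (powR_ge0 _ _)) -(powR_mulrn _ a1).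
rewrite !powRM ?mulr_ge0 ?powR_ge0// -!powRrM -powRN.
rewrite -mulrA -mulrA; congr (_ * _); rewrite [RHS]mulrC; congr (_ * _).
  by congr (_ `^ _); ring.
rewrite -powRD; last by rewrite (gt_eqF T0) implybT.
by congr (_ `^ _); field.
Qed.

Theorem theorem1p6 (R : realType) (c beta : R) (hc : 0 < c) (hbeta : 1 < beta) :
  exists C1 C2 : R,
    [/\ 0 < C1, C1 <= C2 &
      forall a b : R, 0 < a -> 0 < b ->
        ((C1 * ((1 + 4 * a * b) `^ (beta - 3 / 2) / a `^ (2 * (beta - 1))))%:E
           <= f_int c beta a b)%E /\
        (f_int c beta a b
           <= (C2 * ((1 + 4 * a * b) `^ (beta - 3 / 2)
                     / a `^ (2 * (beta - 1))))%:E)%E].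
Proof.
set C1 := 2 `^ (- beta) * expR (- (c / 4)).
set C2 := (16 * beta / c) `^ beta / 2
     + (2 * 2^-1 `^ (1 - beta) / (beta - 1)
        + (2^-1 `^ (- beta) * Num.sqrt (32 / c) * Num.sqrt (pi *+ 2)
           + 16 / c * (4 `^ (1 - beta) / (beta - 1)))).
(* The power of 4 is the factor between [L ^ (1 - beta) * t] and the stated rate; the maximum makes
   the constants ordered by construction. *)
exists (C1 * 4 `^ (1 - beta)), (Num.max C1 C2 * 4 `^ (1 - beta)).
split; first by rewrite !mulr_gt0 ?powR_gt0 ?expR_gt0.
  by rewrite ler_wpM2r ?powR_ge0// le_max lexx.
move=> a b a0 b0; have ab0 : 0 < 4 * a * b by rewrite !mulr_gt0.
set T := 1 + 4 * a * b; have T0 : 0 < T by rewrite addr_gt0.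
pose t := T `^ (- 2^-1).
have t0 : 0 < t by rewrite powR_gt0.
have tT : t ^+ 2 * T = 1.
  rewrite /t -(powR_mulrn _ (powR_ge0 _ _)) -powRrM mulNr mulVf// powR_inv1 ?ltW//.
  by rewrite mulVf// gt_eqF.
have t1 : t <= 1.
  rewrite -(@ler_pXn2r _ 2)// ?nnegrE ?(ltW t0)// expr1n -tT.
  by rewrite ler_peMr ?sqr_ge0// lerDl ltW.
pose L := 4 * a ^+ 2 * t ^+ 2.
have LbE : L * b = a * (1 - t ^+ 2).
  (* Here [4ab = T - 1], hence [4ab * t ^ 2 = t ^ 2 * T - t ^ 2]. *)
  transitivity (a * (t ^+ 2 * T - t ^+ 2)); last by rewrite tT.
  by rewrite /L /T; ring.
have rate (K : R) : K * 4 `^ (1 - beta) *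
    (T `^ (beta - 3 / 2) / a `^ (2 * (beta - 1))) = K * (L `^ (1 - beta) * t).
  by rewrite -mulrA -scaled_rateE.
rewrite !rate; split.
  exact: f_int_ge_scaled.
apply: (@le_trans _ _ (C2 * (L `^ (1 - beta) * t))%:E).
  exact: f_int_le_scaled.
rewrite lee_fin ler_wpM2r//.
  by rewrite mulr_ge0 ?powR_ge0 ?(ltW t0).
by rewrite le_max lexx orbT.
Qed.
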